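(* Consider a one-holed torus with a pants decomposition consisting of one curve, a dual graph with a loop edge $f_1$ (parameters $e_1,t_1$) and a boundary edge $f_2$ oriented outward (parameter $e_2$), as described in the context. (a) If the counterclockwise order at the trivalent vertex is (initial half of $f_1$, $f_2$, terminal half of $f_1$), then $(\mathbb{Z}/2\mathbb{Z})^2$ acts by $$(e_1\to e_1^{-1})\cdot(e_1,t_1)=(e_1^{-1},t_1^{-1}),\qquad (e_2\to e_2^{-1})\cdot(e_2,t_1)=\Bigl(e_2^{-1},\ \Bigl(\frac{e_2-e_1^2}{e_1^2e_2-1}\Bigr)^2t_1\Bigr).$$ (b) If the counterclockwise order at the trivalent vertex is (initial half of $f_1$, terminal half of $f_1$, $f_2$), then $(\mathbb{Z}/2\mathbb{Z})^2$ acts by $$(e_1\to e_1^{-1})\cdot(e_1,t_1)=(e_1^{-1},t_1^{-1}),\qquad (e_2\to e_2^{-1})\cdot(e_2,t_1)=(e_2^{-1},t_1).$$ (Parameters not written are unchanged.)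
   Context: Setting. Let $T$ be an oriented one-holed torus with trivalent vertex $v$ of the dual graph as base point. $\alpha_1,\alpha_2,\delta_1\in\pi_1(T)$ are the loops following respectively the initial half of $f_1$, the terminal half of $f_1$, and $f_2$ to the boundary of the pair of pants obtained by cutting $T$ along the pants curve, once around it counterclockwise (hole on the left), and back; $\beta_1$ is the loop traversing $f_1$. Then $\alpha_2^{-1}=\beta_1^{-1}\alpha_1\beta_1$, and $\alpha_1\delta_1\alpha_2=1$ in case (a), $\alpha_1\alpha_2\delta_1=1$ in case (b). $\rho:\pi_1(T)\to\mathrm{SL}(2,\mathbb{C})$ is a representation such that $\rho(\alpha_1)$ and $\rho(\delta_1)$ have exactly two fixed points on $\mathbb{C}P^1$ and the restriction of $\rho$ to $\langle\alpha_1,\alpha_2,\delta_1\rangle$ is irreducible (no common fixed point in $\mathbb{C}P^1$). $e_1$ is a chosen eigenvalue of $\rho(\alpha_1)$, $e_2$ a chosen eigenvalue of $\rho(\delta_1)$; $x_1$ (resp. $y_1$) is the fixed point of $\rho(\alpha_1)$ given by the eigenvector for $e_1$ (resp. $e_1^{-1}$), $x_2$ the fixed point of $\rho(\delta_1)$ for $e_2$. The twist parameter $t_1\in\mathbb{C}^*$ is the unique number such that the matrix with eigenvalue $\sqrt{-t_1}$ at $x_1$ and $1/\sqrt{-t_1}$ at $y_1$ sends: in case (a), $x_2$ to $\rho(\beta_1)x_2$; in case (b), $\rho(\beta_1)^{-1}x_1$ (the fixed point of $\rho(\alpha_2)$ for the eigenvalue $e_1^{-1}$) to $\rho(\beta_1)x_1$.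 (This is the twist parameter of the four-holed sphere obtained by passing to the cyclic cover unwrapping $f_1$.) The element $(e_i\to e_i^{-1})$ replaces the choice of eigenvalue $e_i$ by $e_i^{-1}$ and $t_1$ by the twist parameter of the same representation computed with the new choice. *)

(* Defs.v *)
From HB Require Import structures.
From mathcomp Require Import all_boot all_order all_algebra all_fingroup.
From mathcomp Require Import complex reals.
Set Implicit Arguments.
Unset Strict Implicit.
Unset Printing Implicit Defensive.
Import Order.TTheory GRing.Theory Num.Theory.
Local Open Scope ring_scope.

(* The counterclockwise cyclic order of the three half-edges at the trivalent
   vertex. *)
Variant vertex_order :=
  | init_boundary_term  (* initial half of f_1, f_2, terminal half of f_1 *)
  | init_term_boundary. (* initial half of f_1, terminal half of f_1, f_2 *)

Definition freely_generated (G : groupType) (a b : G) : Prop :=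
  forall (H : groupType) (x y : H),
  exists f : {multiplicative G -> H},
    [/\ f a = x, f b = y &
        forall g : {multiplicative G -> H}, g a = x -> g b = y -> g =1 f].

(* The fundamental group of the one-holed torus based at the trivalent vertex,
   with its marked loops. It is free of rank two, on the loop around the pants
   curve and the dual loop. *)
Record one_holed_torus (o : vertex_order) := OneHoledTorus {
  pi1 :> groupType;
  alpha1 : pi1;
  alpha2 : pi1;
  delta1 : pi1;
  beta1 : pi1;
  pi1_free : freely_generated alpha1 beta1;
  alpha2E : (alpha2^-1 = beta1^-1 * alpha1 * beta1)%g;
  pants_relation :
    match o with
    | init_boundary_term => (alpha1 * delta1 * alpha2 = 1)%g
    | init_term_boundary => (alpha1 * alpha2 * delta1 = 1)%g
    end
}.
Arguments alpha1 {o} _.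
Arguments alpha2 {o} _.
Arguments delta1 {o} _.
Arguments beta1 {o} _.

Inductive generated (G : groupType) (S : G -> Prop) : G -> Prop :=
  | generated_gen g : S g -> generated S g
  | generated_one : generated S 1%g
  | generated_mul g h : generated S g -> generated S h -> generated S (g * h)%g
  | generated_inv g : generated S g -> generated S (g^-1)%g.

(* The subgroup < alpha_1, alpha_2, delta_1 >. *)
Definition pants_subgroup (o : vertex_order) (T : one_holed_torus o) : T -> Prop :=
  generated (fun g => g = alpha1 T \/ g = alpha2 T \/ g = delta1 T).

Section ProjectiveLine.

Variable R : realType.
Local Notation C := R[i].

(* Points of the complex projective line are the lines of C^2. *)
Definition CP1 := {L : {vspace 'cV[C]_2} | \dim L == 1%N}.

Definition lin (M : 'M[C]_2) : 'End('cV[C]_2) := linfun (mulmx M).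

Definition transform (M : 'M[C]_2) (L : {vspace 'cV[C]_2}) : {vspace 'cV[C]_2} :=
  (lin M @: L)%VS.

Definition fixed_by (M : 'M[C]_2) (x : CP1) : Prop :=
  transform M (val x) = val x.

Definition exactly_two_fixed_points (M : 'M[C]_2) : Prop :=
  exists x y : CP1, x <> y /\ forall z : CP1, fixed_by M z <-> z = x \/ z = y.

Definition eigenpoint (M : 'M[C]_2) (e : C) (x : CP1) : Prop :=
  (val x <= passmx.leigenspace (lin M) e)%VS.

End ProjectiveLine.

Section TwistCoordinates.

Variables (R : realType) (o : vertex_order) (T : one_holed_torus o).
Local Notation C := R[i].

Record SL2_representation (rho : T -> 'M[C]_2) : Prop := {
  rho_mul : forall g h : T, rho (g * h)%g = rho g *m rho h;
  rho_det : forall g : T, \det (rho g) = 1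
}.

Record admissible (rho : T -> 'M[C]_2) : Prop := {
  adm_repr : SL2_representation rho;
  adm_alpha1 : exactly_two_fixed_points (rho (alpha1 T));
  adm_delta1 : exactly_two_fixed_points (rho (delta1 T));
  adm_irr : ~ exists x : CP1 R,
              forall g : T, pants_subgroup g -> fixed_by (rho g) x
}.

Record eigenvalue_choice (rho : T -> 'M[C]_2) (e1 e2 : C) : Prop := {
  choice_e1 : passmx.leigenvalue (lin (rho (alpha1 T))) e1;
  choice_e2 : passmx.leigenvalue (lin (rho (delta1 T))) e2
}.

(* The choice of square root is irrelevant: it only changes M into - M. *)
Definition is_twist_parameter (rho : T -> 'M[C]_2) (e1 e2 t1 : C) : Prop :=
  t1 != 0 /\
  exists (x1 y1 x2 : CP1 R) (M : 'M[C]_2),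
    [/\ eigenpoint (rho (alpha1 T)) e1 x1,
        eigenpoint (rho (alpha1 T)) e1^-1 y1 &
        eigenpoint (rho (delta1 T)) e2 x2] /\
    [/\ eigenpoint M (sqrtC (- t1)) x1,
        eigenpoint M (sqrtC (- t1))^-1 y1 &
        match o with
        | init_boundary_term =>
            transform M (val x2) = transform (rho (beta1 T)) (val x2)
        | init_term_boundary =>
            transform M (transform (invmx (rho (beta1 T))) (val x1))
              = transform (rho (beta1 T)) (val x1)
        end].

Record param := Param { eig1 : C; eig2 : C; twist1 : C }.

Definition has_param (rho : T -> 'M[C]_2) (p : param) : Prop :=
  [/\ admissible rho, eigenvalue_choice rho (eig1 p) (eig2 p) &
      is_twist_parameter rho (eig1 p) (eig2 p) (twist1 p)].

Definition param_space := {p : param | exists rho : T -> 'M[C]_2, has_param rho p}.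

(* The group (Z/2Z)^2, with the i-th factor generated by (e_i -> e_i^-1). *)
Definition flips : finGroupType := ('Z_2 * 'Z_2)%type.
Definition flip1 : flips := (1%R, 0%R).
Definition flip2 : flips := (0%R, 1%R).

Definition flip_eigenvalue (s : 'Z_2) (e : C) : C := if s == 0 then e else e^-1.

Definition twist_well_defined : Prop :=
  forall (rho : T -> 'M[C]_2) (e1 e2 : C),
    admissible rho -> eigenvalue_choice rho e1 e2 ->
    exists! t1 : C, is_twist_parameter rho e1 e2 t1.

(* Each g replaces the chosen eigenvalues as prescribed, and t_1 by the twist
   parameter of the same representation for the new choice, whichever
   representation with the given parameters is used. *)
Definition changes_eigenvalue_choice (to : {action flips &-> param_space}) : Prop :=
  forall (rho : T -> 'M[C]_2) (p : param_space) (g : flips),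
    has_param rho (sval p) ->
    [/\ eig1 (sval (to p g)) = flip_eigenvalue g.1 (eig1 (sval p)),
        eig2 (sval (to p g)) = flip_eigenvalue g.2 (eig2 (sval p)) &
        has_param rho (sval (to p g))].

End TwistCoordinates.
Arguments twist_well_defined R {o} T.
Arguments param_space R {o} T.

(* Main.v *)
Require Import Defs.
From mathcomp Require Import all_boot all_order all_algebra all_fingroup.
From mathcomp Require Import complex reals boolp ring.
(** Choose eigenvectors X, Y of rho(alpha1), with eigenvalues e1 and 1/e1, as a
basis, and let [[p, q], [r, s]] be the matrix of rho(beta1) in it. A common
eigenvector of rho(alpha1) and rho(alpha2) would be fixed by the whole pants
subgroup, so irreducibility makes p, q, r, s nonzero. If x2 = u X + v Y, the
twisting matrix diag(m, 1/m) with m^2 = - t1 sends x2 to rho(beta1) x2 iff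
(p u + q v) v = - t1 u (r u + s v).

In case (a) the pants relation gives beta1 alpha1 delta1 = alpha1 beta1.
Applied to x2 it eliminates u and v and yields
  t1 = - (p / s) (e1^2 e2 - 1) / (e1^2 - e2);
in case (b) the same computation with rho(beta1)^-1 x1 for x2 and rho(beta1) x1
for its image yields t1 = p / s. Replacing e1 by 1/e1 exchanges X and Y, hence p
and s, and replacing e2 by 1/e2 leaves p and s unchanged. *)

Set Implicit Arguments.
Unset Strict Implicit.
Unset Printing Implicit Defensive.
Import Order.TTheory GRing.Theory Num.Theory.
Local Open Scope ring_scope.

(** * Lines of the complex plane, eigenvectors and eigenbases *)

Section ProjectiveLine.

Variable R : realType.
Local Notation C := R[i].
Implicit Types (M A B : 'M[C]_2) (v w V X Y : 'cV[C]_2) (x : CP1 R).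

Lemma linE M v : lin M v = M *m v.
Proof. by rewrite lfunE. Qed.

Lemma CP1_line x : exists2 v, v != 0 & val x = <[v]>%VS.
Proof.
case: x => L /= /eqP dimL; exists (vpick L); first by rewrite vpick0 -dimv_eq0 dimL.
apply/eqP; rewrite eq_sym eqEdim -memvE memv_pick dimL dim_vline vpick0.
by rewrite -dimv_eq0 dimL.
Qed.

Lemma line_CP1 v : v != 0 -> exists x, val x = <[v]>%VS.
Proof.
move=> v0; have dimv : \dim <[v]> == 1%N by rewrite dim_vline v0.
by exists (exist _ <[v]>%VS dimv).
Qed.

Lemma line_eqP v w : v != 0 ->
  (<[v]> = <[w]>)%VS <-> exists2 c, c != 0 & v = c *: w.
Proof.
move=> v0; split=> [vw|[c c0 ->]].
  have /vlineP[c vE] : (v \in <[w]>)%VS by rewrite -vw memv_line.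
  by exists c => //; apply: contraNneq v0 => c0; rewrite vE c0 scale0r.
apply: subv_anti; rewrite -!memvE; apply/andP; split; apply/vlineP.
  by exists c.
by exists c^-1; rewrite scalerA mulVf // scale1r.
Qed.

Lemma transform_line M v : transform M <[v]>%VS = <[M *m v]>%VS.
Proof. by rewrite /transform limg_line linE. Qed.

Lemma mem_leigenspace M e v :
  (v \in passmx.leigenspace (lin M) e) = (M *m v == e *: v).
Proof.
by rewrite memv_ker add_lfunE opp_lfunE scale_lfunE id_lfunE linE subr_eq0.
Qed.

Lemma eigenpointE M e x v : val x = <[v]>%VS ->
  eigenpoint M e x <-> M *m v = e *: v.
Proof.
by move=> xv; rewrite /eigenpoint xv -memvE mem_leigenspace; split=> /eqP.
Qed.

Lemma leigenvalueP M e :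
  passmx.leigenvalue (lin M) e <-> exists2 v : 'cV[C]_2, v != 0 & M *m v = e *: v.
Proof.
split=> [E|[v v0 Mv]].
  exists (vpick (passmx.leigenspace (lin M) e)); first by rewrite vpick0.
  by apply/eqP; rewrite -mem_leigenspace memv_pick.
apply: contraNneq v0 => E0.
by rewrite -memv0 -E0 mem_leigenspace Mv.
Qed.

Lemma det1_unit M : \det M = 1 -> M \in unitmx.
Proof. by rewrite unitmxE => ->; rewrite unitr1. Qed.

Lemma mulmx_unit_eq0 M v : M \in unitmx -> (M *m v == 0) = (v == 0).
Proof.
move=> uM; apply/eqP/eqP=> [Mv|->]; last by rewrite mulmx0.
by rewrite -(mulKmx uM v) Mv mulmx0.
Qed.

Lemma fixed_byP M x v : M \in unitmx -> v != 0 -> val x = <[v]>%VS ->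
  fixed_by M x <-> exists2 c, c != 0 & M *m v = c *: v.
Proof.
by move=> uM v0 xv; rewrite /fixed_by xv transform_line line_eqP ?mulmx_unit_eq0.
Qed.

Lemma eigenvalue_neq0 M v e : M \in unitmx -> v != 0 -> M *m v = e *: v ->
  e != 0.
Proof.
move=> uM v0 Mv; apply: contraNneq v0 => e0.
by rewrite -(mulmx_unit_eq0 _ uM) Mv e0 scale0r.
Qed.

Definition independent X Y :=
  forall a b : C, a *: X + b *: Y = 0 -> a = 0 /\ b = 0.

Lemma independent_sym X Y : independent X Y -> independent Y X.
Proof. by move=> XY a b; rewrite addrC => /XY[-> ->]. Qed.

Lemma coord_inj X Y a b c d : independent X Y ->
  a *: X + b *: Y = c *: X + d *: Y -> a = c /\ b = d.
Proof.
move=> XY /eqP; rewrite -subr_eq0 opprD addrACA -!scalerBl => /eqP /XY[].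
by move=> /eqP; rewrite subr_eq0 => /eqP -> /eqP; rewrite subr_eq0 => /eqP.
Qed.

Lemma independent_neq0 X Y : independent X Y -> X != 0.
Proof.
move=> XY; apply/negP=> /eqP X0; have := XY 1 0.
by rewrite X0 scaler0 scale0r addr0 => /(_ erefl)[/eqP]; rewrite oner_eq0.
Qed.

Lemma independent_span X Y w : independent X Y ->
  exists a b, w = a *: X + b *: Y.
Proof.
move=> XY; have Y0 := independent_neq0 (independent_sym XY).
have fXY : free [:: X; Y].
  rewrite free_cons span_seq1 seq1_free Y0 andbT; apply/vlineP => -[k XE].
  have := XY 1 (- k); rewrite scale1r scaleNr XE subrr => /(_ erefl)[/eqP].
  by rewrite oner_eq0.
have /span_basis span : basis_of fullv [:: X; Y].
  by rewrite basisEfree fXY subvf dimvf.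
have : w \in <<[:: X; Y]>>%VS by rewrite span memvf.
rewrite span_cons span_seq1 => /memv_addP[_ /vlineP[a ->] [_ /vlineP[b ->] ->]].
by exists a, b.
Qed.

Lemma distinct_points_independent (x y : CP1 R) X Y :
  X != 0 -> Y != 0 -> val x = <[X]>%VS -> val y = <[Y]>%VS -> x <> y ->
  independent X Y.
Proof.
move=> X0 Y0 xX yY xy c d E.
have [c0|c0] := eqVneq c 0.
  split=> //; move/eqP: E; rewrite c0 scale0r add0r scaler_eq0 (negPf Y0) orbF.
  by move/eqP.
case: xy; apply: val_inj; rewrite xX yY; apply/(line_eqP _ X0); exists (- (d / c)).
  apply: contraNneq X0 => dc; have : d = 0.
    by apply/eqP; move/eqP: dc; rewrite oppr_eq0 mulf_eq0 invr_eq0 (negPf c0) orbF.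
  by move/eqP: E => /[swap] ->; rewrite scale0r addr0 scaler_eq0 (negPf c0).
apply: (scalerI c0); move/eqP: E; rewrite addr_eq0 => /eqP ->.
by rewrite scalerA mulrN mulrCA divff // mulr1 scaleNr.
Qed.

(** The matrix [P] with columns [X] and [Y] conjugates [M] to diag(a, b). Sizes are written [1 + 1]
    so that the block matrix lemmas apply. *)
Lemma det_eigen M X Y a b : independent X Y ->
  M *m X = a *: X -> M *m Y = b *: Y -> \det M = a * b.
Proof.
move=> XY MX MY.
pose P : 'M[C]_(1 + 1) := row_mx X Y.
(* A nonzero vector in the kernel of the transpose side would be a linear relation between [X] and
   [Y]. *)
have P0 : \det P != 0.
  rewrite -det_tr; apply/det0P=> -[z z0]; rewrite -[z]hsubmxK tr_row_mx mul_row_col.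
  rewrite [lsubmx z]mx11_scalar [rsubmx z]mx11_scalar !mul_scalar_mx.
  move/(congr1 trmx); rewrite linearD !linearZ /= !trmxK trmx0 => /XY[l0 r0].
  case/eqP: z0; rewrite -[z]hsubmxK [lsubmx z]mx11_scalar [rsubmx z]mx11_scalar l0 r0.
  by rewrite !raddf0 row_mx0.
have MP : (M : 'M_(1 + 1)) *m P = P *m block_mx a%:M 0 0 b%:M.
  by rewrite mul_mx_row MX MY mul_row_block !mulmx0 addr0 add0r !mul_mx_scalar.
have /(congr1 determinant) := MP; rewrite !det_mulmx det_ublock !det_scalar1.
by move=> detMP; apply: (mulIf P0); rewrite [RHS]mulrC.
Qed.

(** The two fixed lines carry eigenvectors with eigenvalues [a] and [b], and a b = 1 because the
    determinant is 1. Applied to alpha1 it supplies the basis of the whole computation, applied to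
    delta1 it supplies x2 and excludes e2 = 1. *)
Lemma two_fixed_points_eigenbasis M e :
  \det M = 1 -> exactly_two_fixed_points M -> passmx.leigenvalue (lin M) e ->
  [/\ e != 0, e ^+ 2 != 1 &
   exists X Y, [/\ independent X Y, M *m X = e *: X & M *m Y = e^-1 *: Y]].
Proof.
move=> detM [x [y [xy fixM]]] /leigenvalueP[V V0 MV].
have uM := det1_unit detM.
have [X X0 xX] := CP1_line x; have [Y Y0 yY] := CP1_line y.
have XY := distinct_points_independent X0 Y0 xX yY xy.
have [_ /(_ (or_introl erefl)) /(fixed_byP uM X0 xX)[a a0 MX]] := fixM x.
have [_ /(_ (or_intror erefl)) /(fixed_byP uM Y0 yY)[b b0 MY]] := fixM y.
have ab : a * b = 1 by rewrite -(det_eigen XY MX MY).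
have bE : b = a^-1 by apply: (mulfI a0); rewrite ab divff.
(* With equal eigenvalues the line of [X + Y] would be a third fixed point. *)
have a_neq : a != b.
  apply/eqP=> aE; have XY0 : X + Y != 0.
    apply/eqP=> E; have := XY 1 1; rewrite !scale1r => /(_ E)[/eqP].
    by rewrite oner_eq0.
  have [z zE] := line_CP1 XY0.
  have : fixed_by M z.
    by apply/(fixed_byP uM XY0 zE); exists a => //; rewrite mulmxDr MX MY aE scalerDr.
  case/fixM=> zxy; move: zE; rewrite zxy ?xX ?yY.
    move=> /esym/(line_eqP _ XY0)[c _].
    rewrite -[X in X + _]scale1r -[Y]scale1r -[c *: X]addr0 -(scale0r Y).
    by move=> /(coord_inj XY)[_ /eqP]; rewrite oner_eq0.
  move=> /esym/(line_eqP _ XY0)[c _].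
  rewrite -[X in X + _]scale1r -[Y in _ + Y]scale1r -[c *: Y]add0r -(scale0r X).
  by move=> /(coord_inj XY)[/eqP]; rewrite oner_eq0.
have a2 : a ^+ 2 != 1.
  by apply: contra a_neq => /eqP a2; rewrite bE; apply/eqP/(mulfI a0); rewrite divff.
have [c [d VE]] := independent_span V XY.
(* Expanding an eigenvector for [e] in the basis shows that [e] is [a] or [b]; in the second case
   [X] and [Y] trade places. *)
have : (c * (a - e)) *: X + (d * (b - e)) *: Y = 0.
  have /eqP := MV; rewrite VE mulmxDr -!scalemxAr MX MY scalerDr -subr_eq0 !scalerA.
  rewrite opprD addrACA -!scalerBl => /eqP <-.
  by congr (_ *: _ + _ *: _); ring.
move=> /XY[/eqP ca /eqP db].
have [eE|ea] := eqVneq a e; first by rewrite -eE; split=> //; exists X, Y; rewrite -bE.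
have [eE|eb] := eqVneq b e.
  rewrite -eE bE invrK; split.
  - by rewrite invr_eq0.
  - by rewrite exprVn invr_eq1.
  - by exists Y, X; rewrite -bE; split=> //; exact: independent_sym.
case/eqP: V0; rewrite VE; move: ca db; rewrite !mulf_eq0 !subr_eq0 (negPf ea) (negPf eb) !orbF.
by move=> /eqP -> /eqP ->; rewrite !scale0r addr0.
Qed.

(** A combination of [M] and the identity is diagonal in the same basis. Its two coefficients can be
    solved for since [a] differs from its inverse, so no change of basis is needed. *)
Lemma twist_matrix M (X Y : 'cV[C]_2) (a m : C) :
  independent X Y -> a != 0 -> a ^+ 2 != 1 ->
  M *m X = a *: X -> M *m Y = a^-1 *: Y ->
  exists N : 'M[C]_2, N *m X = m *: X /\ N *m Y = m^-1 *: Y.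
Proof.
move=> XY a0 a2 MX MY; have d0 : a - a^-1 != 0.
  apply: contra a2; rewrite subr_eq0 => /eqP aE.
  by apply/eqP; rewrite expr2 {2}aE divff.
pose k := (m - m^-1) / (a - a^-1); exists (k *: M + (m - k * a)%:M).
have kd : k * (a - a^-1) = m - m^-1 by rewrite divfK.
rewrite !mulmxDl -!scalemxAl !mul_scalar_mx MX MY !scalerA -!scalerDl.
split; congr (_ *: _); first by ring.
have -> : k * a^-1 + (m - k * a) = m - k * (a - a^-1) by ring.
by rewrite kd; ring.
Qed.

(** Simple eigenvalues have a single eigenline, so the points x1 and y1 in the definition of the
    twist parameter must be the lines of the basis vectors. *)
Lemma eigenspace_line M X Y V (a b : C) : independent X Y ->
  M *m X = a *: X -> M *m Y = b *: Y -> a != b -> V != 0 -> M *m V = a *: V ->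
  <[V]>%VS = <[X]>%VS.
Proof.
move=> XY MX MY ab V0; have [c [d VE]] := independent_span V XY.
rewrite {1 2}VE mulmxDr -!scalemxAr MX MY scalerDr !scalerA => /(coord_inj XY)[_ /eqP].
rewrite mulrC -subr_eq0 -mulrBl mulf_eq0 subr_eq0 eq_sym (negPf ab) /= => /eqP d0.
apply/(line_eqP _ V0); exists c; last by rewrite VE d0 scale0r addr0.
by apply: contraNneq V0 => c0; rewrite VE c0 d0 !scale0r addr0.
Qed.

(** In the affine coordinate u / v the matrix acts as multiplication by m^2, so the condition is k /
    l = m^2 u / v. Only m^2 enters, hence the choice of square root disappears. *)
Lemma twist_image_line M (X Y : 'cV[C]_2) (m u v k l : C) :
  independent X Y -> m != 0 ->
  M *m X = m *: X -> M *m Y = m^-1 *: Y ->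
  u != 0 -> v != 0 -> k != 0 -> l != 0 ->
  (<[M *m (u *: X + v *: Y)]> = <[k *: X + l *: Y]>)%VS
    <-> k * v = m ^+ 2 * u * l.
Proof.
move=> XY m0 MX MY u0 v0 k0 l0.
have -> : M *m (u *: X + v *: Y) = (m * u) *: X + (m^-1 * v) *: Y.
  by rewrite mulmxDr -!scalemxAr MX MY !scalerA [u * m]mulrC [v * _]mulrC.
have MW0 : (m * u) *: X + (m^-1 * v) *: Y != 0.
  by apply/eqP=> /XY[/eqP]; rewrite mulf_eq0 (negPf m0) (negPf u0).
rewrite line_eqP //; split=> [[c c0]|E].
  rewrite scalerDr !scalerA => /(coord_inj XY)[E1 E2].
  apply: (mulfI c0); rewrite mulrA -E1.
  have -> : v = m * (c * l) by rewrite -E2 mulrA divff // mul1r.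
  by ring.
(* The scaling factor is forced by the [X] coordinates. *)
exists (m * u / k); first by rewrite !mulf_neq0 ?invr_eq0.
rewrite scalerDr !scalerA divfK //; congr (_ + _ *: _).
apply: (mulIf k0); have -> : m^-1 * v * k = m^-1 * (k * v) by ring.
by rewrite E; field; rewrite m0 k0.
Qed.

End ProjectiveLine.

(** The two equations are the coordinates of alpha1 beta1 V = f beta1 alpha1 V for V = u X + v Y.
    They make the coordinates [k], [l] of beta1 V proportional to p u and s v, so that (k v) / (u l)
    depends only on [a], [f] and p / s, whichever V is used. *)
Lemma boundary_twist (F : fieldType) (a f p q r s u v : F) :
  a != 0 -> a ^+ 2 != 1 -> f != 0 -> f != 1 -> p != 0 -> s != 0 ->
  (u != 0) || (v != 0) -> 
  a * (p * u + q * v) = f * (p * (a * u) + q * (a^-1 * v)) ->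
  a^-1 * (r * u + s * v) = f * (r * (a * u) + s * (a^-1 * v)) ->
  [/\ [/\ u != 0, v != 0, p * u + q * v != 0 & r * u + s * v != 0],
      a ^+ 2 - f != 0, a ^+ 2 * f - 1 != 0 &
      forall t, (p * u + q * v) * v = - t * u * (r * u + s * v) <->
        t = - (p / s) * ((a ^+ 2 * f - 1) / (a ^+ 2 - f))].
Proof.
move=> a0 a2 f0 f1 p0 s0 uv0 E1 E2; set k := p * u + q * v; set l := r * u + s * v.
have Ek : (a ^+ 2 - f) * k = f * (a ^+ 2 - 1) * p * u.
  have -> : (a ^+ 2 - f) * k = a * (a * k) - f * k by ring.
  by rewrite E1 /k; field.
have El : (a ^+ 2 * f - 1) * l = f * (a ^+ 2 - 1) * s * v.
  have -> : (a ^+ 2 * f - 1) * l = a ^+ 2 * f * l - a * (a^-1 * l) by field.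
  by rewrite E2 /l; field.
have a21 : a ^+ 2 - 1 != 0 by rewrite subr_eq0.
have f1' : f - 1 != 0 by rewrite subr_eq0.
(* If [u] vanished, [El] would reduce to (f - 1) s v = 0; similarly [Ek] rules out [v = 0]. *)
have u0 : u != 0.
  apply/eqP=> u0; move: uv0 El; rewrite u0 eqxx /= /l u0 mulr0 add0r => v0 El.
  have : (f - 1) * (s * v) = 0.
    have -> : (f - 1) * (s * v) =
      (a ^+ 2 * f - 1) * (s * v) - f * (a ^+ 2 - 1) * s * v by ring.
    by rewrite El subrr.
  by apply/eqP; rewrite !mulf_neq0.
have v0 : v != 0.
  apply/eqP=> v0; move: Ek; rewrite /k v0 mulr0 addr0 => Ek.
  have : a ^+ 2 * (f - 1) * (p * u) = 0.
    have -> : a ^+ 2 * (f - 1) * (p * u) =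
      f * (a ^+ 2 - 1) * p * u - (a ^+ 2 - f) * (p * u) by ring.
    by rewrite Ek subrr.
  by apply/eqP; rewrite !mulf_neq0 ?expf_neq0.
have : (a ^+ 2 - f) * k != 0 by rewrite Ek !mulf_neq0.
rewrite mulf_eq0 negb_or => /andP[af0 k0].
have : (a ^+ 2 * f - 1) * l != 0 by rewrite El !mulf_neq0.
rewrite mulf_eq0 negb_or => /andP[af1 l0].
split=> // t; pose c := f * (a ^+ 2 - 1) * p * s.
have c0 : c != 0 by rewrite !mulf_neq0.
(* Multiplying by [c] lets [Ek] and [El] trade [u] and [v] for [k] and [l]; a factor linear in [t]
   remains. *)
have cross : c * (k * v + t * u * l)
    = k * l * (p * (a ^+ 2 * f - 1) + t * s * (a ^+ 2 - f)).
  have -> : c * (k * v + t * u * l) =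
    k * p * (f * (a ^+ 2 - 1) * s * v) + t * l * s * (f * (a ^+ 2 - 1) * p * u).
    by rewrite /c; ring.
  by rewrite -Ek -El; ring.
split=> [E|tE].
  have : k * l * (p * (a ^+ 2 * f - 1) + t * s * (a ^+ 2 - f)) = 0.
    by rewrite -cross E; ring.
  move/eqP; rewrite !mulf_eq0 (negPf k0) (negPf l0) /= addr_eq0 => /eqP pE.
  have -> : - (p / s) * ((a ^+ 2 * f - 1) / (a ^+ 2 - f))
    = - (p * (a ^+ 2 * f - 1)) / (s * (a ^+ 2 - f)) by field; rewrite s0 af0.
  by rewrite pE; field; rewrite s0 af0.
have tE0 : p * (a ^+ 2 * f - 1) + t * s * (a ^+ 2 - f) = 0.
  by rewrite tE; field; rewrite s0 af0.
by apply/eqP; rewrite !mulNr -addr_eq0 -(inj_eq (mulfI c0)) mulr0 cross tE0 mulr0.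
Qed.

(** * Representations of the torus group and adapted bases *)

Lemma pants_relation_or o (T : one_holed_torus o) :
  (alpha1 T * delta1 T * alpha2 T = 1)%g \/ (alpha1 T * alpha2 T * delta1 T = 1)%g.
Proof. by case: o T => T; have := pants_relation T; [left|right]. Qed.

Section OneHoledTorus.

Variables (R : realType) (o : vertex_order) (T : one_holed_torus o).
Local Notation C := R[i].
Implicit Types (rho : T -> 'M[C]_2) (V W X Y : 'cV[C]_2).

(* In the basis (X, Y), [rho (alpha1 T)] is diag(a, a^-1) and [rho (beta1 T)] is
   [[p, q], [r, s]]. *)
Record frame rho (a : C) X Y (p q r s : C) : Prop := Frame {
  frame_independent : independent X Y;
  frame_a0 : a != 0;
  frame_a2 : a ^+ 2 != 1;
  frame_alphaX : rho (alpha1 T) *m X = a *: X;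
  frame_alphaY : rho (alpha1 T) *m Y = a^-1 *: Y;
  frame_betaX : rho (beta1 T) *m X = p *: X + r *: Y;
  frame_betaY : rho (beta1 T) *m Y = q *: X + s *: Y;
  frame_p0 : p != 0;
  frame_q0 : q != 0;
  frame_r0 : r != 0;
  frame_s0 : s != 0
}.

Section Representation.

Variable rho : T -> 'M[C]_2.
Hypothesis rep : SL2_representation rho.

Lemma rep_unit g : rho g \in unitmx.
Proof. by rewrite det1_unit // rho_det. Qed.

Lemma rep1 : rho 1%g = 1%:M.
Proof.
have u1 := rep_unit 1%g; rewrite -[LHS](mulmxK u1) -rho_mul // mulg1.
by rewrite mulmxV.
Qed.

Lemma repV g : rho g^-1%g = invmx (rho g).
Proof.
by rewrite -[LHS](mulmxK (rep_unit g)) -rho_mul // mulVg rep1 mul1mx.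
Qed.

Definition eigenvector V g := exists2 c : C, c != 0 & rho g *m V = c *: V.

Lemma eigenvectorM V g h :
  eigenvector V g -> eigenvector V h -> eigenvector V (g * h)%g.
Proof.
move=> [c c0 gV] [d d0 hV]; exists (c * d); first exact: mulf_neq0.
by rewrite rho_mul // -mulmxA hV -scalemxAr gV scalerA mulrC.
Qed.

Lemma eigenvectorV V g : eigenvector V g -> eigenvector V g^-1%g.
Proof.
move=> [c c0 gV]; exists c^-1; first by rewrite invr_eq0.
apply: (scalerI c0); rewrite scalerA mulfV // scale1r scalemxAr -gV repV.
by rewrite mulKmx ?rep_unit.
Qed.

(** In either cyclic order the pants relation writes delta1 as a word in alpha1 and alpha2. *)
Lemma eigenvector_delta V : eigenvector V (alpha1 T) -> eigenvector V (alpha2 T) ->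
  eigenvector V (delta1 T).
Proof.
move=> V1 V2; case: (pants_relation_or T) => E.
  have -> : delta1 T = ((alpha1 T)^-1 * (alpha2 T)^-1)%g.
    apply: (mulgI (alpha1 T)); apply: (mulIg (alpha2 T)).
    by rewrite E mulgA mulgV mul1g mulVg.
  by apply: eigenvectorM; apply: eigenvectorV.
have -> : delta1 T = (alpha1 T * alpha2 T)^-1%g.
  by apply: (mulgI (alpha1 T * alpha2 T)%g); rewrite E mulgV.
by apply/eigenvectorV/eigenvectorM.
Qed.

Lemma eigenvector_generated (S : T -> Prop) V g : (forall h, S h -> eigenvector V h) ->
  Defs.generated S g -> eigenvector V g.
Proof.
move=> SV; elim=> [h /SV //||h k _ hV _ kV|h _ hV].
- by exists 1; rewrite ?oner_eq0 // rep1 mul1mx scale1r.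
- exact: eigenvectorM.
- exact: eigenvectorV.
Qed.

End Representation.

Section Admissible.

Variables (rho : T -> 'M[C]_2) (e1 e2 : C).
Hypotheses (adm : admissible rho) (choice : eigenvalue_choice rho e1 e2).
Let rep := adm_repr adm.
Local Notation A := (rho (alpha1 T)).
Local Notation B := (rho (beta1 T)).
Local Notation D := (rho (delta1 T)).

(* V would be fixed by alpha1 and by alpha2^-1 = beta1^-1 alpha1 beta1. *)
Lemma no_common_eigenvector V (c d : C) : V != 0 ->
  A *m V = c *: V -> A *m (B *m V) = d *: (B *m V) -> False.
Proof.
move=> V0 AV ABV; have uA := rep_unit rep (alpha1 T); have uB := rep_unit rep (beta1 T).
have [x xV] := line_CP1 V0; apply: (adm_irr adm); exists x => g.
have V1 : eigenvector rho V (alpha1 T) by exists c => //; exact: eigenvalue_neq0 V0 AV.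
have V2 : eigenvector rho V (alpha2 T).
  rewrite -[alpha2 T]invgK; apply: eigenvectorV => //; exists d.
    by apply: eigenvalue_neq0 uA _ ABV; rewrite mulmx_unit_eq0.
  rewrite alpha2E !rho_mul // repV // -!mulmxA ABV -scalemxAr mulKmx //.
move=> /(eigenvector_generated rep (V := V)) gV.
apply/(fixed_byP (rep_unit rep g) V0 xV)/gV => h [|[|]] -> //.
exact: eigenvector_delta.
Qed.

(** If an entry of beta1 vanished, beta1 would send [X] or [Y] into one of the two eigenlines of
    alpha1, which [no_common_eigenvector] forbids. *)
Lemma frame_exists : exists X Y p q r s, frame rho e1 X Y p q r s.
Proof.
have [a0 a2 [X [Y [XY AX AY]]]] :=
  two_fixed_points_eigenbasis (rho_det rep _) (adm_alpha1 adm) (choice_e1 choice).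
have X0 := independent_neq0 XY; have Y0 := independent_neq0 (independent_sym XY).
have [p [r BX]] := independent_span (B *m X) XY.
have [q [s BY]] := independent_span (B *m Y) XY.
exists X, Y, p, q, r, s; split=> //; apply/eqP=> z0.
- apply: (@no_common_eigenvector X e1 e1^-1) => //.
  by rewrite BX z0 scale0r add0r -scalemxAr AY !scalerA mulrC.
- apply: (@no_common_eigenvector Y e1^-1 e1^-1) => //.
  by rewrite BY z0 scale0r add0r -scalemxAr AY !scalerA mulrC.
- apply: (@no_common_eigenvector X e1 e1) => //.
  by rewrite BX z0 scale0r addr0 -scalemxAr AX !scalerA mulrC.
- apply: (@no_common_eigenvector Y e1^-1 e1) => //.
  by rewrite BY z0 scale0r addr0 -scalemxAr AX !scalerA mulrC.
Qed.

Lemma frame_flip X Y p q r s : frame rho e1 X Y p q r s ->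
  frame rho e1^-1 Y X s r q p.
Proof.
case=> XY a0 a2 AX AY BX BY p0 q0 r0 s0.
split; rewrite ?invr_eq0 ?invrK // 1?addrC //.
- exact: independent_sym.
- by rewrite exprVn invr_eq1.
Qed.

(** The points x1 and y1 are replaced by the basis vectors, which is legitimate because e1 and its
    inverse are distinct. The point x2 stays existential, as the vector [W]. *)
Lemma twist_parameter_frame X Y p q r s (t : C) : frame rho e1 X Y p q r s ->
  is_twist_parameter rho e1 e2 t <->
  t != 0 /\ exists W (M : 'M[C]_2),
    [/\ W != 0, D *m W = e2 *: W, M *m X = sqrtC (- t) *: X,
        M *m Y = (sqrtC (- t))^-1 *: Y &
        match o with
        | init_boundary_term => <[M *m W]>%VS = <[B *m W]>%VS
        | init_term_boundary => <[M *m (invmx B *m X)]>%VS = <[B *m X]>%VS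
        end].
Proof.
case=> XY a0 a2 AX AY _ _ _ _ _.
have X0 := independent_neq0 XY; have Y0 := independent_neq0 (independent_sym XY).
have aV : e1^-1 - e1 != 0.
  apply: contra a2; rewrite subr_eq0 => /eqP aE.
  by apply/eqP; rewrite expr2 -{1}aE mulVf.
split=> -[t0 ]; last first.
  move=> [W [M [W0 DW MX MY H]]]; split=> //.
  have [x1 x1E] := line_CP1 X0; have [y1 y1E] := line_CP1 Y0; have [x2 x2E] := line_CP1 W0.
  exists x1, y1, x2, M; split; split.
  - exact/(eigenpointE _ _ x1E).
  - exact/(eigenpointE _ _ y1E).
  - exact/(eigenpointE _ _ x2E).
  - exact/(eigenpointE _ _ x1E).
  - exact/(eigenpointE _ _ y1E).
  by move: H; rewrite x1E x2E !transform_line.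
move=> [x1 [y1 [x2 [M [[Ax1 Ay1 Dx2] [Mx1 My1 H]]]]]]; split=> //.
have [V1 V10 V1E] := CP1_line x1; have [V2 V20 V2E] := CP1_line y1.
have [W W0 WE] := CP1_line x2.
have x1E : val x1 = <[X]>%VS.
  rewrite V1E; apply: (eigenspace_line XY AX AY _ V10); first by rewrite eq_sym -subr_eq0.
  exact/(eigenpointE _ _ V1E).
have y1E : val y1 = <[Y]>%VS.
  rewrite V2E; apply: (eigenspace_line (independent_sym XY) AY AX _ V20).
    by rewrite -subr_eq0.
  exact/(eigenpointE _ _ V2E).
exists W, M; split.
- exact: W0.
- exact/(eigenpointE _ _ WE).
- exact/(eigenpointE _ _ x1E).
- exact/(eigenpointE _ _ y1E).
by move: H; rewrite x1E WE !transform_line.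
Qed.

End Admissible.

End OneHoledTorus.

(** * Closed formulas for the twist parameter and the effect of the flips *)

Section TwistFormula.

Variable R : realType.
Local Notation C := R[i].

Lemma sqrtCN_neq0 (t : C) : t != 0 -> sqrtC (- t) != 0.
Proof. by move=> t0; rewrite sqrtC_eq0 oppr_eq0. Qed.

Lemma twist_formula_boundary (T : one_holed_torus init_boundary_term)
    (rho : T -> 'M[C]_2) (e1 e2 : C) X Y p q r s :
  admissible rho -> eigenvalue_choice rho e1 e2 -> frame rho e1 X Y p q r s ->
  [/\ e1 ^+ 2 - e2 != 0, e1 ^+ 2 * e2 - 1 != 0 &
   forall t, is_twist_parameter rho e1 e2 t <->
     t = - (p / s) * ((e1 ^+ 2 * e2 - 1) / (e1 ^+ 2 - e2))].
Proof.
move=> adm choice F; have rep := adm_repr adm.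
have [f0 f2 [W1 [W2 [W12 DW1 _]]]] :=
  two_fixed_points_eigenbasis (rho_det rep _) (adm_delta1 adm) (choice_e2 choice).
have W10 := independent_neq0 W12.
have f1 : e2 != 1 by apply: contra f2 => /eqP ->; rewrite expr1n.
have [XY a0 a2 AX AY BX BY p0 q0 r0 s0] := F.
have betaE (u v : C) : rho (beta1 T) *m (u *: X + v *: Y)
    = (p * u + q * v) *: X + (r * u + s * v) *: Y.
  rewrite mulmxDr -!scalemxAr BX BY !scalerDr !scalerA addrACA -!scalerDl.
  by congr (_ *: _ + _ *: _); ring.
have alphaE (u v : C) : rho (alpha1 T) *m (u *: X + v *: Y)
    = (e1 * u) *: X + (e1^-1 * v) *: Y.
  by rewrite mulmxDr -!scalemxAr AX AY !scalerA mulrC [v * _]mulrC.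
(* The pants relation reads beta1 alpha1 delta1 = alpha1 beta1. *)
have relation (V : 'cV[C]_2) : rho (delta1 T) *m V = e2 *: V ->
    rho (alpha1 T) *m (rho (beta1 T) *m V) =
    e2 *: (rho (beta1 T) *m (rho (alpha1 T) *m V)).
  move=> DV; rewrite !scalemxAr -DV !mulmxA -!rho_mul //.
  congr (rho _ *m _); have := pants_relation T => /= E.
  have -> : delta1 T = ((alpha1 T)^-1 * (alpha2 T)^-1)%g.
    apply: (mulgI (alpha1 T)); apply: (mulIg (alpha2 T)).
    by rewrite E mulgA mulgV mul1g mulVg.
  by rewrite alpha2E !mulgA mulgK mulgV mul1g.
(* Stated for every eigenvector: a given twist parameter comes with an unknown [W], whereas [W1]
   serves to exhibit one. *)
have coords (W : 'cV[C]_2) : W != 0 -> rho (delta1 T) *m W = e2 *: W ->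
    exists u v : C, [/\ W = u *: X + v *: Y,
      [/\ u != 0, v != 0, p * u + q * v != 0 & r * u + s * v != 0],
      e1 ^+ 2 - e2 != 0, e1 ^+ 2 * e2 - 1 != 0 &
      forall t, (p * u + q * v) * v = - t * u * (r * u + s * v) <->
        t = - (p / s) * ((e1 ^+ 2 * e2 - 1) / (e1 ^+ 2 - e2))].
  move=> W0 DW; have [u [v WE]] := independent_span W XY; exists u, v.
  have uv : (u != 0) || (v != 0).
    apply: contraNT W0; rewrite negb_or !negbK WE => /andP[/eqP -> /eqP ->].
    by rewrite !scale0r addr0.
  have := relation _ DW; rewrite WE betaE !alphaE betaE scalerDr !scalerA.
  move=> /(coord_inj XY)[E1 E2].
  by have [] := boundary_twist a0 a2 f0 f1 p0 s0 uv E1 E2; split.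
have [u1 [v1 [W1E [u10 v10 k10 l10] d1 d2 tE1]]] := coords W1 W10 DW1.
split=> // t; rewrite (twist_parameter_frame e2 t F); split.
  move=> [t0 [W [M [W0 DW MX MY H]]]].
  have [u [v [WE [u0 v0 k0 l0] _ _ tE]]] := coords W W0 DW; apply/tE.
  move: H; rewrite WE betaE.
  move/(twist_image_line XY (sqrtCN_neq0 t0) MX MY u0 v0 k0 l0) ->.
  by rewrite sqrtCK.
(* With [t = 0] the right side of [E] vanishes, while its left side is a product of nonzero
   coordinates. *)
move=> /tE1 E; have t0 : t != 0.
  apply/eqP=> t0; move/eqP: E; rewrite t0 oppr0 !mul0r mulf_eq0.
  by rewrite (negPf k10) (negPf v10).
split=> //; have [M [MX MY]] := twist_matrix (sqrtC (- t)) XY a0 a2 AX AY.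
exists W1, M; split=> //; rewrite W1E betaE.
by apply/(twist_image_line XY (sqrtCN_neq0 t0) MX MY u10 v10 k10 l10); rewrite sqrtCK.
Qed.

(** With beta1^-1 X = z X + w Y and beta1 X = p X + r Y, the twist condition is p w = - t z r. The
    [Y] coordinate of beta1 beta1^-1 X gives z r = - w s, and [w] cancels. The result is free of e2,
    whence the trivial effect of the second flip on t1. *)
Lemma twist_formula_term (T : one_holed_torus init_term_boundary)
    (rho : T -> 'M[C]_2) (e1 e2 : C) X Y p q r s :
  admissible rho -> eigenvalue_choice rho e1 e2 -> frame rho e1 X Y p q r s ->
  forall t, is_twist_parameter rho e1 e2 t <-> t = p / s.
Proof.
move=> adm choice F t; have rep := adm_repr adm.
have [_ _ [W [W' [W12 DW _]]]] :=
  two_fixed_points_eigenbasis (rho_det rep _) (adm_delta1 adm) (choice_e2 choice).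
have W0 := independent_neq0 W12.
have [XY a0 a2 AX AY BX BY p0 q0 r0 s0] := F.
have [z [w ZE]] := independent_span (invmx (rho (beta1 T)) *m X) XY.
have : rho (beta1 T) *m (z *: X + w *: Y) = X by rewrite -ZE mulKVmx // rep_unit.
rewrite mulmxDr -!scalemxAr BX BY !scalerDr !scalerA addrACA -!scalerDl.
rewrite -[RHS]addr0 -[X in _ = X + _]scale1r -(scale0r Y) => /(coord_inj XY)[E1 E2].
have z0 : z != 0.
  apply/eqP=> z0; move: E2 E1; rewrite z0 !mul0r !add0r => /eqP.
  rewrite mulf_eq0 (negPf s0) orbF => /eqP ->; rewrite mul0r => /eqP.
  by rewrite eq_sym oner_eq0.
have w0 : w != 0.
  apply/eqP=> w0; move/eqP: E2; rewrite w0 mul0r addr0 mulf_eq0.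
  by rewrite (negPf z0) (negPf r0).
have tE : p * w = - t * z * r <-> t = p / s.
  have zr : z * r = - (w * s) by apply/eqP; rewrite -addr_eq0 E2.
  rewrite -mulrA zr mulrNN mulrCA [p * w]mulrC; split=> [/(mulfI w0) ->|->].
    by rewrite mulfK.
  by rewrite divfK.
rewrite (twist_parameter_frame e2 t F) -tE; split.
  move=> [t0 [V [M [_ _ MX MY]]]]; rewrite ZE BX.
  by move/(twist_image_line XY (sqrtCN_neq0 t0) MX MY z0 w0 p0 r0) ->; rewrite sqrtCK.
move=> E; have t0 : t != 0 by have /tE -> := E; rewrite mulf_neq0 ?invr_eq0.
split=> //; have [M [MX MY]] := twist_matrix (sqrtC (- t)) XY a0 a2 AX AY.
exists W, M; split=> //; rewrite ZE BX.
by apply/(twist_image_line XY (sqrtCN_neq0 t0) MX MY z0 w0 p0 r0); rewrite sqrtCK.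
Qed.

Definition flip2_factor o (e1 e2 : C) : C :=
  match o with
  | init_boundary_term => ((e2 - e1 ^+ 2) / (e1 ^+ 2 * e2 - 1)) ^+ 2
  | init_term_boundary => 1
  end.

(** Inverting e1 swaps numerator and denominator up to the common factor e1^-2. This makes the two
    flips commute. *)
Lemma flip2_factorV1 o (e1 e2 : C) : e1 != 0 ->
  flip2_factor o e1^-1 e2 = (flip2_factor o e1 e2)^-1.
Proof.
case: o => e10 /=; last by rewrite invr1.
rewrite -exprVn invf_div; congr (_ ^+ 2).
have -> : e2 - e1^-1 ^+ 2 = e1^-1 ^+ 2 * (e1 ^+ 2 * e2 - 1) by field.
have -> : e1^-1 ^+ 2 * e2 - 1 = e1^-1 ^+ 2 * (e2 - e1 ^+ 2) by field.
by rewrite -mulf_div divff ?mul1r // expf_neq0 ?invr_eq0.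
Qed.

(** The same swap, now with common factor - e2^-1; it makes the second flip an involution. *)
Lemma flip2_factorV2 o (e1 e2 : C) : e2 != 0 ->
  flip2_factor o e1 e2^-1 = (flip2_factor o e1 e2)^-1.
Proof.
case: o => e20 /=; last by rewrite invr1.
rewrite -exprVn invf_div; congr (_ ^+ 2).
have -> : e2^-1 - e1 ^+ 2 = - e2^-1 * (e1 ^+ 2 * e2 - 1) by field.
have -> : e1 ^+ 2 * e2^-1 - 1 = - e2^-1 * (e2 - e1 ^+ 2) by field.
by rewrite -mulf_div divff ?mul1r // oppr_eq0 invr_eq0.
Qed.

Lemma twist_formula o (T : one_holed_torus o) (rho : T -> 'M[C]_2) (e1 e2 : C)
    X Y p q r s :
  admissible rho -> eigenvalue_choice rho e1 e2 -> frame rho e1 X Y p q r s ->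
  exists t0, forall t, is_twist_parameter rho e1 e2 t <-> t = t0.
Proof.
move=> adm choice F; case: o T rho adm choice F => T rho adm choice F.
  by have [_ _] := twist_formula_boundary adm choice F;
    exists (- (p / s) * ((e1 ^+ 2 * e2 - 1) / (e1 ^+ 2 - e2))).
by exists (p / s); exact: twist_formula_term adm choice F.
Qed.

Lemma eigenvalue_choiceV1 o (T : one_holed_torus o) (rho : T -> 'M[C]_2) (e1 e2 : C) :
  admissible rho -> eigenvalue_choice rho e1 e2 -> eigenvalue_choice rho e1^-1 e2.
Proof.
move=> adm [E1 E2]; split; last exact: E2.
have rep := adm_repr adm.
have [_ _ [X [Y [XY _ AY]]]] :=
  two_fixed_points_eigenbasis (rho_det rep _) (adm_alpha1 adm) E1.
by apply/leigenvalueP; exists Y; [exact: independent_neq0 (independent_sym XY)|exact: AY].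
Qed.

Lemma eigenvalue_choiceV2 o (T : one_holed_torus o) (rho : T -> 'M[C]_2) (e1 e2 : C) :
  admissible rho -> eigenvalue_choice rho e1 e2 -> eigenvalue_choice rho e1 e2^-1.
Proof.
move=> adm [E1 E2]; split; first exact: E1.
have rep := adm_repr adm.
have [_ _ [X [Y [XY _ AY]]]] :=
  two_fixed_points_eigenbasis (rho_det rep _) (adm_delta1 adm) E2.
by apply/leigenvalueP; exists Y; [exact: independent_neq0 (independent_sym XY)|exact: AY].
Qed.


Lemma has_param_neq0 o (T : one_holed_torus o) (rho : T -> 'M[C]_2) (e1 e2 t : C) :
  has_param rho (Param e1 e2 t) ->
  [/\ e1 != 0, e2 != 0 & flip2_factor o e1 e2 != 0].
Proof.
case=> /= adm choice _; have rep := adm_repr adm.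
have [X [Y [p [q [r [s F]]]]]] := frame_exists adm choice.
have [e20 _ _] :=
  two_fixed_points_eigenbasis (rho_det rep _) (adm_delta1 adm) (choice_e2 choice).
split=> //; first exact: frame_a0 F.
case: o T rho adm choice F {rep} => T rho adm choice F /=; last exact: oner_neq0.
have [d1 d2 _] := twist_formula_boundary adm choice F.
by rewrite expf_neq0 // mulf_neq0 ?invr_eq0 // -opprB oppr_eq0.
Qed.

(** Exchanging [X] and [Y] inverts p / s. In case (a) the factor (e1^2 e2 - 1) / (e1^2 - e2) is
    inverted too when e1 is. *)
Lemma has_param_flip1 o (T : one_holed_torus o) (rho : T -> 'M[C]_2) (e1 e2 t : C) :
  has_param rho (Param e1 e2 t) -> has_param rho (Param e1^-1 e2 t^-1).
Proof.
case=> /= adm choice tw; have choice' := eigenvalue_choiceV1 adm choice.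
split; [exact: adm|exact: choice'|move=> /=].
have [X [Y [p [q [r [s F]]]]]] := frame_exists adm choice.
have F' := frame_flip F.
case: o T rho adm choice choice' tw F F' => T rho adm choice choice' tw F F'.
  have [d1 d2 /(_ t)[/(_ tw) tE _]] := twist_formula_boundary adm choice F.
  have [d1' d2' /(_ t^-1)[_]] := twist_formula_boundary adm choice' F'; apply.
  have a0 := frame_a0 F; have p0 := frame_p0 F; have s0 := frame_s0 F.
  (* This is the denominator e1^-2 - e2 of the new formula after multiplication by e1^2, in the form
     met by [field]. *)
  have d3 : 1 + - e2 * e1 ^+ 2 != 0.
    have -> : 1 + - e2 * e1 ^+ 2 = - (e1 ^+ 2 * e2 - 1) by ring.
    by rewrite oppr_eq0.
  by rewrite tE; field; rewrite p0 s0 a0 d1 d2 d3.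
apply/(twist_formula_term adm choice' F').
by have /(twist_formula_term adm choice F) -> := tw; rewrite invf_div.
Qed.

(** The frame does not involve e2, so p / s is kept. In case (a) the factor (e1^2 e2 - 1) / (e1^2 -
    e2) turns into its inverse, and the quotient of new by old is the square in [flip2_factor]. *)
Lemma has_param_flip2 o (T : one_holed_torus o) (rho : T -> 'M[C]_2) (e1 e2 t : C) :
  has_param rho (Param e1 e2 t) ->
  has_param rho (Param e1 e2^-1 (flip2_factor o e1 e2 * t)).
Proof.
move=> H; have [e10 e20 _] := has_param_neq0 H; move: H.
case=> /= adm choice tw; have choice' := eigenvalue_choiceV2 adm choice.
split; [exact: adm|exact: choice'|move=> /=].
have [X [Y [p [q [r [s F]]]]]] := frame_exists adm choice.
case: o T rho adm choice choice' tw F => T rho adm choice choice' tw F /=.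
  have [d1 d2 /(_ t)[/(_ tw) tE _]] := twist_formula_boundary adm choice F.
  have [d1' d2' /(_ (((e2 - e1 ^+ 2) / (e1 ^+ 2 * e2 - 1)) ^+ 2 * t))[_]] :=
    twist_formula_boundary adm choice' F; apply.
  have s0 := frame_s0 F.
  rewrite tE; field.
  by rewrite s0 e20 d1 d2.
apply/(twist_formula_term adm choice' F).
by have /(twist_formula_term adm choice F) -> := tw; rewrite mul1r.
Qed.

End TwistFormula.

(** * The action of the group of flips on the parameter space *)

Section Action.

Variables (R : realType) (o : vertex_order) (T : one_holed_torus o).
Local Notation C := R[i].
Implicit Types (p : param R) (s : param_space R T) (g h : flips).

Definition flip1_param p := Param (eig1 p)^-1 (eig2 p) (twist1 p)^-1.

Definition flip2_param p :=
  Param (eig1 p) (eig2 p)^-1 (flip2_factor o (eig1 p) (eig2 p) * twist1 p).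

(** The order of the two flips is a convention, harmless on actual parameters by [flip12_paramC]. *)
Definition flip_param g p :=
  let p1 := if g.1 == 0 then p else flip1_param p in
  if g.2 == 0 then p1 else flip2_param p1.

Lemma has_flip_param (rho : T -> 'M[C]_2) g p :
  has_param rho p -> has_param rho (flip_param g p).
Proof.
move=> pP; rewrite /flip_param.
have p1P : has_param rho (if g.1 == 0 then p else flip1_param p).
  case: eqP => _; first exact: pP.
  by case: p pP => e1 e2 t pP; exact: has_param_flip1 pP.
move: (if _ then _ else _) p1P => p1 p1P; case: eqP => _; first exact: p1P.
by case: p1 p1P => e1 e2 t p1P; exact: has_param_flip2 p1P.
Qed.

Lemma flip_space_subproof g s :
  exists rho : T -> 'M[C]_2, has_param rho (flip_param g (sval s)).
Proof. by case: s => p [rho pP]; exists rho; exact: has_flip_param. Qed.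

Definition flip_space s g : param_space R T := exist _ _ (flip_space_subproof g s).

Lemma param_space_inj s s' : sval s = sval s' -> s = s'.
Proof.
case: s s' => [p pP] [p' p'P] /= pp'; case: _ / pp' in p'P *.
by congr exist; exact: Prop_irrelevance.
Qed.

Lemma flip1_paramK : involutive flip1_param.
Proof. by case=> *; rewrite /flip1_param /= !invrK. Qed.

(** The second application multiplies by the inverse factor; the two cancel because the factor is
    nonzero on parameters of an actual representation. *)
Lemma flip2_paramK (rho : T -> 'M[C]_2) p : has_param rho p ->
  flip2_param (flip2_param p) = p.
Proof.
case: p => e1 e2 t /has_param_neq0[e10 e20 f0].
by rewrite /flip2_param /= invrK flip2_factorV2 // mulKf.
Qed.

Lemma flip12_paramC (rho : T -> 'M[C]_2) p : has_param rho p ->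
  flip2_param (flip1_param p) = flip1_param (flip2_param p).
Proof.
case: p => e1 e2 t /has_param_neq0[e10 e20 f0].
by rewrite /flip2_param /flip1_param /= flip2_factorV1 // invfM.
Qed.

(** Turns the group law into Boolean tests, so that compatibility with products becomes a check of
    sixteen cases. *)
Lemma mulg_Z2_eq0 (x y : 'Z_2) : ((x * y)%g == 0) = ((x == 0) == (y == 0)).
Proof. by move: x y => [[|[|//]] ?] [[|[|//]] ?]. Qed.

Lemma flip_paramM (rho : T -> 'M[C]_2) g h p : has_param rho p ->
  flip_param (g * h)%g p = flip_param h (flip_param g p).
Proof.
move=> pP; have p2P : has_param rho (flip2_param p) := has_flip_param flip2 pP.
rewrite /flip_param /= !mulg_Z2_eq0.
case: (g.1 == 0); case: (h.1 == 0); case: (g.2 == 0); case: (h.2 == 0) => /=;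
  by rewrite ?(flip12_paramC pP) ?flip1_paramK ?(flip12_paramC p2P) ?(flip2_paramK pP).
Qed.

Lemma flip_space_act1 : flip_space^~ 1%g =1 id.
Proof. by move=> s; exact: param_space_inj. Qed.

Lemma flip_space_actM s : act_morph flip_space s.
Proof.
move=> g h; apply: param_space_inj => /=.
by case: s => p [rho pP] /=; exact: flip_paramM pP.
Qed.

Definition flip_action : {action flips &-> param_space R T} :=
  TotalAction flip_space_act1 flip_space_actM.

Lemma flip_action_changes_eigenvalue_choice : changes_eigenvalue_choice flip_action.
Proof.
move=> rho s g sP; split; last exact: has_flip_param.
  by rewrite /= /flip_param /flip_eigenvalue; case: ifP; case: ifP.
by rewrite /= /flip_param /flip_eigenvalue; case: ifP; case: ifP.
Qed.

Lemma flip_actionE s (e1 e2 t1 : C) : sval s = Param e1 e2 t1 ->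
  sval (flip_action s flip1) = Param e1^-1 e2 t1^-1 /\
  sval (flip_action s flip2) = Param e1 e2^-1 (flip2_factor o e1 e2 * t1).
Proof. by move=> /= ->. Qed.

Lemma twist_parameter_well_defined : twist_well_defined R T.
Proof.
move=> rho e1 e2 adm choice.
have [X [Y [p [q [r [s F]]]]]] := frame_exists adm choice.
have [t0 tE] := twist_formula adm choice F.
by exists t0; split=> [|t /tE //]; exact/tE.
Qed.

End Action.

Theorem theorem9p2 (R : realType) :
  (forall T : one_holed_torus init_boundary_term,
     twist_well_defined R T /\
     exists to : {action flips &-> param_space R T},
       changes_eigenvalue_choice to /\
       forall (p : param_space R T) (e1 e2 t1 : R[i]), sval p = Param e1 e2 t1 ->
         sval (to p flip1) = Param e1^-1 e2 t1^-1 /\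
         sval (to p flip2)
           = Param e1 e2^-1 (((e2 - e1 ^+ 2) / (e1 ^+ 2 * e2 - 1)) ^+ 2 * t1))
  /\
  (forall T : one_holed_torus init_term_boundary,
     twist_well_defined R T /\
     exists to : {action flips &-> param_space R T},
       changes_eigenvalue_choice to /\
       forall (p : param_space R T) (e1 e2 t1 : R[i]), sval p = Param e1 e2 t1 ->
         sval (to p flip1) = Param e1^-1 e2 t1^-1 /\
         sval (to p flip2) = Param e1 e2^-1 t1).
Proof.
split=> T; split; try exact: twist_parameter_well_defined;
  exists (flip_action R T); split.
- exact: flip_action_changes_eigenvalue_choice.
- by move=> p e1 e2 t1 /flip_actionE.
- exact: flip_action_changes_eigenvalue_choice.
- by move=> p e1 e2 t1 /flip_actionE /=; rewrite mul1r.
Qed.
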